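(* Let $X$ be a set, let $(R_x)_{x\in X}$ be a family of local rings, with $\mathfrak{m}_x$ the maximal ideal of $R_x$, and let $\Gamma=\prod_{x\in X}R_x$. For $x\in X$ let $\mathfrak{M}_x=\pi_x^{-1}(\mathfrak{m}_x)$, where $\pi_x:\Gamma\to R_x$ is the canonical projection; it is a maximal ideal of $\Gamma$. Then the space $\operatorname{Max}(\Gamma)$ together with the map $\eta:X\to\operatorname{Max}(\Gamma)$ given by $x\mapsto\mathfrak{M}_x$ is the Stone–Čech compactification of the discrete space $X$.
   Context: All rings are commutative with $1$; a local ring is a ring with exactly one maximal ideal (no Noetherian hypothesis). $\operatorname{Max}(R)$ denotes the set of maximal ideals of a ring $R$, equipped with the topology induced from the Zariski topology of $\operatorname{Spec}(R)$. A compact space means a quasi-compact Hausdorff space. The Stone–Čech compactification of a topological space $X$ is a pair $(\beta X,\eta)$ where $\beta X$ is a compact space and $\eta:X\to\beta X$ is a continuous map such that for each pair $(Y,\varphi)$ with $Y$ a compact space and $\varphi:X\to Y$ continuous, there is a unique continuous map $\widetilde\varphi:\beta X\to Y$ with $\varphi=\widetilde\varphi\circ\eta$. *)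

(* Defs.v *)
From HB Require Import structures.
From mathcomp Require Import all_boot all_algebra.
From mathcomp Require Import all_classical.
From mathcomp Require Import topology.

Set Implicit Arguments.
Unset Strict Implicit.
Unset Printing Implicit Defensive.

Import GRing.Theory.
Local Open Scope classical_set_scope.
Local Open Scope ring_scope.

(* Rings are [comPzRingType]: the zero ring is allowed, because the product
   of an empty family of rings is the zero ring. For the same reason ideals
   are classical sets rather than the [idealr] of ring_quotient, which needs
   a nonzero ring. *)

Section Ideals.
Variable R : comPzRingType.
Implicit Types I J M P : set R.

Definition is_ideal I : Prop :=
  [/\ I 0, forall a b, I a -> I b -> I (a + b) & forall r a, I a -> I (r * a)].

Definition prime_ideal P : Prop :=
  [/\ is_ideal P, P <> [set: R] & forall a b, P (a * b) -> P a \/ P b].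

Definition maximal_ideal M : Prop :=
  [/\ is_ideal M, M <> [set: R]
    & forall J, is_ideal J -> M `<=` J -> J = M \/ J = [set: R]].

Lemma ideal1T I : is_ideal I -> I 1 -> I = [set: R].
Proof.
by case=> _ _ IM I1; apply/seteqP; split=> // a _; rewrite -[a]mulr1; apply: IM.
Qed.

Lemma maximal_ideal_prime M : maximal_ideal M -> prime_ideal M.
Proof.
case=> IM MT Mmax; split=> // a b Mab.
have [M0 MD MM] := IM.
pose J : set R := [set c | exists u r, M u /\ c = u + r * a].
have IJ : is_ideal J.
  split.
  - by exists 0, 0; rewrite mul0r addr0.
  - move=> _ _ [u [r [Mu ->]]] [v [s [Mv ->]]].
    exists (u + v), (r + s); split; first exact: MD.
    by rewrite mulrDl addrACA.
  - move=> t _ [u [r [Mu ->]]]; exists (t * u), (t * r); split; first exact: MM.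
    by rewrite mulrDr mulrA.
have MJ : M `<=` J by move=> u Mu; exists u, 0; rewrite mul0r addr0.
have Ja : J a by exists 0, 1; rewrite mul1r add0r.
have [JM|JT] := Mmax J IJ MJ; first by left; rewrite -JM.
right; have [u [r [Mu e1]]] : J 1 by rewrite JT.
rewrite -[b]mul1r e1 mulrDl -mulrA; apply: MD; last exact: MM.
by rewrite mulrC; apply: MM.
Qed.

End Ideals.

Definition local_ring (R : comPzRingType) : Prop :=
  exists! m : set R, maximal_ideal m.

Record spec (R : comPzRingType) : Type := Spec {
  spec_ideal :> set R;
  spec_prime : prime_ideal spec_ideal }.

HB.instance Definition _ (R : comPzRingType) := gen_eqMixin (spec R).
HB.instance Definition _ (R : comPzRingType) := gen_choiceMixin (spec R).

Section Zariski.
Variable R : comPzRingType.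

Definition zero_locus (E : set R) : set (spec R) := [set p | E `<=` p].

Definition zariski_open : set_system (spec R) :=
  [set U | exists E : set R, ~` U = zero_locus E].

Let zariski_openT : zariski_open setT.
Proof.
exists setT; rewrite setCT; apply/seteqP; split=> // p /= pT.
by have [_ nT _] := spec_prime p; apply: nT; apply/seteqP; split.
Qed.

Let zariski_openI : setI_closed zariski_open.
Proof.
move=> U V [E UE] [F VF].
exists [set c | exists a b, [/\ E a, F b & c = a * b]].
rewrite setCI UE VF; apply/seteqP; split=> p /=.
  have [[_ _ pM] _ _] := spec_prime p.
  move=> [Ep|Fp] _ [a [b [Ea Fb ->]]]; last by apply: pM; apply: Fp.
  by rewrite mulrC; apply: pM; apply: Ep.
move=> EFp; have [[_ _ pM] _ pP] := spec_prime p.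
have [Ep|/existsNP[a /not_implyP[Ea pa]]] := pselect (E `<=` p); first by left.
right=> b Fb; have /pP[//|//] : spec_ideal p (a * b) by apply: EFp; exists a, b.
Qed.

Let zariski_open_bigU (I : Type) (f : I -> set (spec R)) :
  (forall i, zariski_open (f i)) -> zariski_open (\bigcup_i f i).
Proof.
move=> /choice[E fE]; exists (\bigcup_i E i).
rewrite setC_bigcup; apply/seteqP; split=> p /=.
  by move=> fp a [i _ Eia]; have := fp i Logic.I; rewrite fE; apply.
by move=> Ep i _; rewrite fE => a Eia; apply: Ep; exists i.
Qed.

HB.instance Definition _ := isOpenTopological.Build (spec R)
  zariski_openT zariski_openI zariski_open_bigU.

(* As a subset of [spec R] coerced to a type, this carries the library's
   subspace topology on [set_type]. *)
Definition maxspec : set (spec R) := [set p | maximal_ideal p].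

Definition maxspec_point (M : set R) (hM : maximal_ideal M) : maxspec :=
  exist _ (Spec (maximal_ideal_prime hM)) (mem_set (hM : maxspec (Spec _))).

End Zariski.

Section ProductRing.
Variables (X : Type) (R : X -> comPzRingType).

Definition prod_ring : Type := forall x, R x.

HB.instance Definition _ := gen_eqMixin prod_ring.
HB.instance Definition _ := gen_choiceMixin prod_ring.

Implicit Types f g h : prod_ring.

Let zero : prod_ring := fun=> 0.
Let opp f : prod_ring := fun x => - f x.
Let add f g : prod_ring := fun x => f x + g x.
Let one : prod_ring := fun=> 1.
Let mul f g : prod_ring := fun x => f x * g x.

Let addA : associative add.
Proof. by move=> f g h; apply/functional_extensionality_dep => x; apply: addrA. Qed.
Let addC : commutative add.
Proof. by move=> f g; apply/functional_extensionality_dep => x; apply: addrC. Qed.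
Let add0 : left_id zero add.
Proof. by move=> f; apply/functional_extensionality_dep => x; apply: add0r. Qed.
Let addN : left_inverse zero opp add.
Proof. by move=> f; apply/functional_extensionality_dep => x; apply: addNr. Qed.
Let mulA : associative mul.
Proof. by move=> f g h; apply/functional_extensionality_dep => x; apply: mulrA. Qed.
Let mulC : commutative mul.
Proof. by move=> f g; apply/functional_extensionality_dep => x; apply: mulrC. Qed.
Let mul1 : left_id one mul.
Proof. by move=> f; apply/functional_extensionality_dep => x; apply: mul1r. Qed.
Let mulD : left_distributive mul add.
Proof. by move=> f g h; apply/functional_extensionality_dep => x; apply: mulrDl. Qed.

HB.instance Definition _ := GRing.isZmodule.Build prod_ring addA addC add0 addN.
HB.instance Definition _ :=
  GRing.Zmodule_isComPzRing.Build prod_ring mulA mulC mul1 mulD.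

Definition prod_proj (x : X) (f : prod_ring) : R x := f x.

End ProductRing.

Definition compact_hausdorff (Y : topologicalType) : Prop :=
  compact [set: Y] /\ hausdorff_space Y.

Definition is_stone_cech (X Z : topologicalType) (eta : X -> Z) : Prop :=
  [/\ compact_hausdorff Z, continuous eta
    & forall (Y : topologicalType) (phi : X -> Y),
        compact_hausdorff Y -> continuous phi ->
        exists! psi : Z -> Y, continuous psi /\ phi = psi \o eta].

(* Main.v *)
Require Import Defs.
From HB Require Import structures.
From mathcomp Require Import all_boot all_algebra.
From mathcomp Require Import all_classical.
From mathcomp Require Import topology.

Set Implicit Arguments.
Unset Strict Implicit.
Unset Printing Implicit Defensive.

Local Open Scope classical_set_scope.
Local Open Scope ring_scope.

Import GRing.Theory.

(** The maximal ideals of the product are the ultrafilters on [X]. An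
    ultrafilter [U] gives the ideal [ultra_ideal m U] of the [f] that vanish in
    the residue fields over a set of indices in [U]; it is maximal because
    inverses modulo the [m x] can be chosen coordinatewise. A maximal ideal
    [M] gives the ultrafilter [ideal_ultra M] of the sets [S] whose complement
    has its indicator [ind (~` S)] in [M]: as [ind S * ind (~` S) = 0], exactly
    one of the two indicators lies in [M]. These constructions are mutually
    inverse. The nontrivial part is [maximal_zeros]: membership of [f] in [M]
    depends only on the set of [x] with [f x] in [m x]. This is where the rings
    have to be local, since it needs [f x] outside [m x] to be a unit, so that
    [f] divides the indicator of the complement of that set.

    Under this dictionary the point [M_x] is the principal ultrafilter at [x],
    the sets [[set M | ideal_ultra M S]] form a base of the topology, and the
    theorem becomes the construction of the Stone-Cech compactification of a
    discrete space by ultrafilters. The space is compact since an ultrafilter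
    [F] on it converges to the ultrafilter of the sets [S] that belong to
    [F]-almost every point, and Hausdorff since distinct ultrafilters are
    separated by a set and its complement. Each point [z] is the limit of the
    [M_x] along its own ultrafilter, so a continuous extension of [phi] can only
    send [z] to the limit of [phi] along that ultrafilter, which exists and is
    unique in a compact Hausdorff space; regularity of the target makes this
    limit depend continuously on [z]. *)

(** * Maximal ideals and units *)

Section MaximalIdeals.
Variable R : comPzRingType.
Implicit Types (I M : set R) (a b : R).

Lemma maximal_ideal_ideal M : maximal_ideal M -> is_ideal M.
Proof. by case. Qed.

Lemma maximal_ideal1 M : maximal_ideal M -> ~ M 1.
Proof. by case=> MI MT _ /(ideal1T MI). Qed.

(** The quotient by a maximal ideal is a field, so [a] has an inverse [b]
    modulo [M]. *)
Lemma maximal_ideal_inv M a :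
  maximal_ideal M -> ~ M a -> exists b, M (1 - b * a).
Proof.
move=> [[M0 MD MM] _ Mmax] nMa.
pose J : set R := [set c | exists b, M (c - b * a)].
have IJ : is_ideal J.
  split.
  - by exists 0; rewrite mul0r subr0.
  - move=> c d [b Mb] [b' Mb']; exists (b + b').
    by rewrite mulrDl opprD addrACA; apply: MD.
  - move=> r c [b Mb]; exists (r * b).
    by rewrite -mulrA -mulrBr; apply: MM.
have MJ : M `<=` J by move=> c Mc; exists 0; rewrite mul0r subr0.
have Ja : J a by exists 1; rewrite mul1r subrr.
have [JM|JT] := Mmax J IJ MJ; first by case: nMa; rewrite -JM.
by have : J 1 by rewrite JT.
Qed.

Lemma maximal_idealP M : is_ideal M -> ~ M 1 ->
  (forall a, ~ M a -> exists b, M (1 - b * a)) -> maximal_ideal M.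
Proof.
move=> MI M1 Minv; split=> //; first by move=> MT; apply: M1; rewrite MT.
move=> J JI MJ; have [JM|] := pselect (J `<=` M); first by left; apply/seteqP.
move=> /existsNP[a /not_implyP[Ja nMa]].
right; apply: ideal1T => //; have [b Mb] := Minv a nMa.
have [_ JD JM] := JI; rewrite -[1](subrK (b * a)).
by apply: JD; [apply: MJ|apply: JM].
Qed.

(** Krull's theorem. A union over the empty chain is empty, hence not an
    ideal, so Zorn's lemma is applied to the sets that are either empty or
    proper ideals containing [I]. *)
Lemma proper_ideal_sub_maximal I :
  is_ideal I -> ~ I 1 -> exists M, maximal_ideal M /\ I `<=` M.
Proof.
move=> II I1.
pose P (A : set R) := A = set0 \/ [/\ is_ideal A, ~ A 1 & I `<=` A].
have [F FP Ftot|A [PA Amax]] := @Zorn_bigcup R P.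
  have [[A [FA A0]]|noA] := pselect (exists A, F A /\ A !=set0); last first.
    left; apply/seteqP; split=> // x [A FA Ax]; apply: noA.
    by exists A; split => //; exists x.
  have FI B x : F B -> B x -> [/\ is_ideal B, ~ B 1 & I `<=` B].
    by move=> FB Bx; have [B0|//] := FP B FB; move: Bx; rewrite B0.
  have [x Ax] := A0; have [[AI0 _ _] _ IA] := FI A x FA Ax.
  right; split.
  - split; first by exists A.
    + move=> a b [B FB Ba] [C FC Cb].
      have [[_ BD _] _ _] := FI B a FB Ba; have [[_ CD _] _ _] := FI C b FC Cb.
      have [BC|CB] := Ftot B C FB FC.
        by exists C => //; apply: CD => //; apply: BC.
      by exists B => //; apply: BD => //; apply: CB.
    + move=> r a [B FB Ba]; have [[_ _ BM] _ _] := FI B a FB Ba.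
      by exists B => //; apply: BM.
  - by move=> [B FB B1]; have [_ /(_ B1)] := FI B 1 FB B1.
  - by move=> y Iy; exists A => //; apply: IA.
have Pbig B : A `<` B -> is_ideal B -> I `<=` B -> B 1.
  move=> AB BI IB; apply: contrapT => B1.
  by apply: (Amax B AB); right; split.
have [A0|[AI A1 IA]] := PA.
  case: I1; apply: Pbig => //; rewrite A0; split=> // I_set0.
  by case: II => I0 _ _; exact: (I_set0 0 I0).
exists A; split=> //; split=> //; first by move=> AT; apply: A1; rewrite AT.
move=> J JI AJ; have [JA|nJA] := pselect (J `<=` A).
  by left; apply/seteqP.
right; apply: ideal1T => //; apply: Pbig => //.
exact: subset_trans AJ.
Qed.

(** A nonunit generates a proper ideal, hence lies in a maximal one, and [M]
    is the only one. *)
Lemma local_ring_inv M a :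
  local_ring R -> maximal_ideal M -> ~ M a -> exists b, b * a = 1.
Proof.
move=> [M0 [_ M0uniq]] Mmax nMa; apply: contrapT => nunit.
pose J : set R := [set c | exists b, b * a = c].
have JI : is_ideal J.
  split.
  - by exists 0; rewrite mul0r.
  - by move=> _ _ [b <-] [c <-]; exists (b + c); rewrite mulrDl.
  - by move=> r _ [b <-]; exists (r * b); rewrite mulrA.
have [N [Nmax JN]] := proper_ideal_sub_maximal JI nunit.
apply: nMa; rewrite -(M0uniq M Mmax) (M0uniq N Nmax).
by apply: JN; exists 1; rewrite mul1r.
Qed.

End MaximalIdeals.

(** * The topology of the maximal spectrum *)

Section MaxSpec.
Variable R : comPzRingType.
Implicit Types (z w : @maxspec R) (f : R).

Definition max_of z : set R := spec_ideal (val z).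

Lemma max_of_maximal z : maximal_ideal (max_of z).
Proof. by apply: set_mem; apply: (valP z). Qed.

(** Inclusion is enough because the ideals are maximal. *)
Lemma max_of_sub_eq z w : max_of z `<=` max_of w -> z = w.
Proof.
move=> zw; have [_ _ /(_ _ _ zw)] := max_of_maximal z.
case; [exact: maximal_ideal_ideal (max_of_maximal w)| |].
  move=> e; apply: val_inj; rewrite /max_of in e.
  case: (val z) (val w) e => [I pI] [J pJ] /= e.
  by subst J; congr Spec; apply: Prop_irrelevance.
by have [_ wT _] := max_of_maximal w.
Qed.

(** The complement of [zero_locus E] is the union over [f] in [E] of the sets of
    ideals avoiding [f]. *)
Lemma nbhs_maxspecP z (W : set (@maxspec R)) :
  nbhs z W <-> exists f, ~ max_of z f /\ [set w | ~ max_of w f] `<=` W.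
Proof.
split.
  rewrite nbhsE => -[B [[V [E VE] VB] Bz] BW].
  have nEz : ~ zero_locus E (val z).
    by rewrite -VE; apply; move: Bz; rewrite -VB.
  have /existsNP[f /not_implyP[Ef nzf]] := nEz.
  exists f; split=> // w nwf; apply: BW; rewrite -VB.
  apply: contrapT => nVw; have : (~` V) (val w) by [].
  by rewrite VE => /(_ f Ef).
move=> [f [nzf fW]]; apply: (filterS fW); apply: open_nbhs_nbhs; split=> //.
have oV : zariski_open (~` zero_locus [set f]).
  by exists [set f]; rewrite setCK.
exists (~` zero_locus [set f]) => //.
apply/seteqP; split=> w /=; first by move=> nwf wf; apply: nwf => _ ->.
by move=> nwf fw; apply: nwf; apply: fw.
Qed.

Lemma cvg_maxspecP (F : set_system (@maxspec R)) z : Filter F ->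
  (F --> z) <-> (forall f, ~ max_of z f -> F [set w | ~ max_of w f]).
Proof.
move=> FF; split=> [Fz f nzf|Fz W /nbhs_maxspecP[f [nzf fW]]].
  by apply: Fz; apply/nbhs_maxspecP; exists f; split.
by apply: (filterS fW); apply: Fz.
Qed.

End MaxSpec.

(** * Ultrafilters *)

(** Any filter finer than [F] contains no set whose complement is in [F]. *)
Lemma ultraP T (F : set_system T) : ProperFilter F ->
  (forall A, F A \/ F (~` A)) -> UltraFilter F.
Proof.
move=> FF FAC; split=> // G GF FG; apply/seteqP; split=> // A GA.
have [//|/FG GnA] := FAC A; exfalso; apply: (@filter_not_empty _ G).
by rewrite -(setICr A); apply: filterI.
Qed.

Lemma ultra_setC T (F : set_system T) (A : set T) : UltraFilter F ->
  F (~` A) <-> ~ F A.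
Proof.
move=> FU; split; last by have [|//] := in_ultra_setVsetC A FU.
move=> FnA FA; apply: (@filter_not_empty _ F).
by rewrite -(setICr A); apply: filterI.
Qed.

Lemma ultra_fmap T T' (g : T -> T') (F : set_system T) :
  UltraFilter F -> UltraFilter (g @ F).
Proof.
move=> FU; apply: ultraP => A; exact: (in_ultra_setVsetC (g @^-1` A) FU).
Qed.

(** * Ultrafilters and maximal ideals of a product of local rings *)

Section ProductOfLocalRings.
Variables (X : Type) (R : X -> comPzRingType) (m : forall x, set (R x)).
Arguments m : clear implicits.
Hypothesis m_max : forall x, maximal_ideal (m x).
Implicit Types (f g : prod_ring R) (S : set X) (M : set (prod_ring R)).

Definition zeros f : set X := [set x | m x (f x)].

Definition ind S : prod_ring R := fun x => (x \in S)%:R.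

Definition ultra_ideal (U : set_system X) : set (prod_ring R) :=
  [set f | U (zeros f)].

Definition ideal_ultra M : set_system X := [set S | M (ind (~` S))].

Lemma zeros_ind S : zeros (ind S) = ~` S.
Proof.
apply/seteqP; split=> x; rewrite /zeros /ind /=.
  by move=> mS /mem_set xS; move: mS; rewrite xS => /(maximal_ideal1 (m_max x)).
by move=> /(@memNset _ S) ->; case: (maximal_ideal_ideal (m_max x)).
Qed.

(** For a principal ultrafilter this is the maximality of the ideals
    [prod_proj x @^-1` m x]. *)
Lemma ultra_ideal_maximal (U : set_system X) :
  UltraFilter U -> maximal_ideal (ultra_ideal U).
Proof.
move=> UU; have mI x := maximal_ideal_ideal (m_max x).
apply: maximal_idealP.
- split.
  + by apply: filterE => x; case: (mI x).
  + move=> f g Uf Ug; apply: filterS2 Uf Ug => x.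
    by case: (mI x) => _ mD _; apply: mD.
  + move=> r f; apply: filterS => x.
    by case: (mI x) => _ _ mM; apply: mM.
- move=> U1; apply: (@filter_not_empty _ U); apply: filterS U1 => x.
  exact: maximal_ideal1.
- move=> f /(ultra_setC _ UU) nUf.
  have ginv x : exists b : R x, ~ m x (f x) -> m x (1 - b * f x).
    have [mf|/(maximal_ideal_inv (m_max x))[b mb]] := pselect (m x (f x)).
      by exists 0.
    by exists b.
  exists (fun x => projT1 (cid (ginv x))).
  by apply: filterS nUf => x /(projT2 (cid (ginv x))).
Qed.

Lemma principal_ultra_ideal (x : X) :
  ultra_ideal (principal_filter x) = @prod_proj X R x @^-1` m x.
Proof.
apply/seteqP; split=> f; first by move/principal_filterP.
by move=> mfx; apply/principal_filterP.
Qed.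

Lemma prod_ringP f g : (forall x, f x = g x) -> f = g.
Proof. exact: functional_extensionality_dep. Qed.

Lemma prod_ringD f g x : (f + g) x = f x + g x. Proof. by []. Qed.
Lemma prod_ringM f g x : (f * g) x = f x * g x. Proof. by []. Qed.

Lemma ind0 : ind set0 = 0.
Proof. by apply: prod_ringP => x; rewrite /ind in_set0. Qed.

Lemma indI S T : ind (S `&` T) = ind S * ind T.
Proof.
by apply: prod_ringP => x; rewrite prod_ringM /ind in_setI -natrM mulnb.
Qed.

Lemma indC S : ind S + ind (~` S) = 1.
Proof.
apply: prod_ringP => x; rewrite prod_ringD /ind in_setC -natrD.
by case: (x \in S).
Qed.

Lemma ideal_ind_sub M S T :
  is_ideal M -> S `<=` T -> M (ind T) -> M (ind S).
Proof.
by move=> [_ _ MM] /setIidPl <- MT; rewrite indI; apply: MM.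
Qed.

(** The indicators of [S] and of its complement add up to [1] and multiply to
    [0], so a maximal ideal contains exactly one of them. *)
Lemma ideal_ultraP M S : maximal_ideal M ->
  ideal_ultra M S <-> ~ M (ind S).
Proof.
move=> Mmax; have [M0 MD _] := maximal_ideal_ideal Mmax; split.
  move=> MnS MS; apply: (maximal_ideal1 Mmax).
  by rewrite -(indC S); apply: MD.
have [_ _ MP] := maximal_ideal_prime Mmax.
move=> nMS; have /MP[//|//] : M (ind S * ind (~` S)).
by rewrite -indI setICr ind0.
Qed.

Lemma ideal_ultra_ultra M : maximal_ideal M -> UltraFilter (ideal_ultra M).
Proof.
move=> Mmax; have MI := maximal_ideal_ideal Mmax; have [M0 MD _] := MI.
have MF : ProperFilter (ideal_ultra M).
  apply: Build_ProperFilter; last split.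
  - by move=> /(ideal_ultraP _ Mmax); rewrite ind0.
  - by rewrite /ideal_ultra /= setCT ind0.
  - move=> S T; rewrite /ideal_ultra /= => MS MT.
    have -> : ind (~` (S `&` T)) = ind (~` S) + ind (S `&` ~` T).
      apply: prod_ringP => x.
      rewrite prod_ringD /ind !(in_setC, in_setI) -natrD.
      by case: (x \in S); case: (x \in T).
    by apply: MD => //; apply: ideal_ind_sub MT.
  - move=> S T ST; apply: ideal_ind_sub => //.
    exact: subsetC.
apply: ultraP => S; have [|] := pselect (M (ind S)); last first.
  by move=> /(ideal_ultraP S Mmax); left.
by right; rewrite /ideal_ultra /= setCK.
Qed.

Hypothesis R_local : forall x, local_ring (R x).

(** Off its zeros [f] is invertible, so it divides the indicator of the
    complement of [zeros f]. Conversely, if this indicator lies in [M] but [f]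
    does not, then [u = 1 - g * f] lies in [M] for some [g]; the zero sets of
    [u] and [f] are disjoint, although both belong to the ultrafilter of
    [M]. *)
Lemma maximal_zeros M f : maximal_ideal M ->
  M f <-> ideal_ultra M (zeros f).
Proof.
move=> Mmax.
have sub h : M h -> ideal_ultra M (zeros h).
  have [_ MD MM] := maximal_ideal_ideal Mmax.
  have ginv x : exists b : R x, ~ m x (h x) -> b * h x = 1.
    have [mf|] := pselect (m x (h x)); first by exists 0.
    by move=> /(local_ring_inv (R_local x) (m_max x))[b bf]; exists b.
  pose g : prod_ring R := fun x => projT1 (cid (ginv x)).
  have gP x : ~ m x (h x) -> g x * h x = 1 := projT2 (cid (ginv x)).
  move=> Mh; rewrite /ideal_ultra /=.
  have -> : ind (~` zeros h) = (ind (~` zeros h) * g) * h.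
    apply: prod_ringP => x; rewrite !prod_ringM /ind in_setC.
    have [hx|nhx] := pselect (zeros h x); first by rewrite mem_set// !mul0r.
    by rewrite memNset// -mulrA gP// mulr1.
  exact: MM.
split; first exact: sub.
move=> Mzf; apply: contrapT => /(maximal_ideal_inv Mmax)[g /sub Mzu].
have MU := ideal_ultra_ultra Mmax.
apply: (@filter_not_empty _ (ideal_ultra M)).
apply: filterS2 Mzf Mzu => x /= mfx mux.
have [_ mD mM] := maximal_ideal_ideal (m_max x).
apply: (maximal_ideal1 (m_max x)).
have -> : 1 = (1 - g x * f x) + g x * f x by rewrite subrK.
by apply: mD => //; apply: mM.
Qed.

(** * The maximal spectrum of a product of local rings *)

Local Notation MaxG := (@maxspec (prod_ring R)).

Definition ultra_of (z : MaxG) : set_system X := ideal_ultra (max_of z).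

Definition point_of (U : set_system X) (UU : UltraFilter U) : MaxG :=
  maxspec_point (ultra_ideal_maximal UU).

#[local] Instance ultra_of_ultra (z : MaxG) : UltraFilter (ultra_of z).
Proof. exact: ideal_ultra_ultra (max_of_maximal z). Qed.

Lemma ultra_of_zeros (z : MaxG) f : max_of z f <-> ultra_of z (zeros f).
Proof. exact: maximal_zeros (max_of_maximal z). Qed.

Lemma ultra_of_inj (z w : MaxG) : ultra_of z `<=` ultra_of w -> z = w.
Proof.
move=> zw; apply: max_of_sub_eq => f.
by rewrite !ultra_of_zeros; apply: zw.
Qed.

(** These sets are the usual clopen base of the space of ultrafilters; here they
    are Zariski-open because membership of [S] means avoiding [ind S]. *)
Lemma nbhs_ultra_of (z : MaxG) S :
  ultra_of z S -> nbhs z [set w | ultra_of w S].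
Proof.
move=> /(ideal_ultraP S (max_of_maximal z)) zS.
apply/nbhs_maxspecP; exists (ind S); split=> // w.
by move=> /(ideal_ultraP S (max_of_maximal w)).
Qed.

Lemma maxspec_hausdorff : hausdorff_space MaxG.
Proof.
move=> z w zw; apply: ultra_of_inj => S zS.
have [//|wnS] := in_ultra_setVsetC S (ultra_of_ultra w).
have [v [/= vS vnS]] := zw _ _ (nbhs_ultra_of zS) (nbhs_ultra_of wnS).
by have /(ultra_setC _ (ultra_of_ultra v)) := vnS.
Qed.

(** The limit of an ultrafilter [F] is the point of the ultrafilter [U] of the
    sets belonging to [F]-almost every point. *)
Lemma maxspec_compact : compact [set: MaxG].
Proof.
rewrite compact_ultra => F FU _.
pose U : set_system X := [set S | F [set z | ultra_of z S]].
have UU : UltraFilter U.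
  have UF : ProperFilter U.
    apply: Build_ProperFilter; last split.
    - rewrite /U /= => U0; apply: (@filter_not_empty _ F).
      apply: filterS U0 => z z0.
      exact: (@filter_not_empty _ (ultra_of z)).
    - by rewrite /U /=; apply: filterE => z; apply: filterT.
    - by rewrite /U => S T /=; apply: filterS2 => z; apply: filterI.
    - by rewrite /U => S T ST /=; apply: filterS => z; apply: filterS.
  apply: ultraP => S.
  have [|FnS] := in_ultra_setVsetC [set z | ultra_of z S] FU; first by left.
  by right; apply: filterS FnS => z /(ultra_setC _ (ultra_of_ultra z)).
exists (point_of UU); split=> //; apply/cvg_maxspecP => f.
move=> nUf; apply/(ultra_setC [set z | max_of z f] FU) => Ff; apply: nUf.
by apply: filterS Ff => z /= /ultra_of_zeros.
Qed.

Lemma ultra_of_principal (z : MaxG) x S :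
  max_of z = @prod_proj X R x @^-1` m x -> ultra_of z S <-> S x.
Proof.
move=> zE; rewrite /ultra_of /ideal_ultra /= zE.
by rewrite -{2}(setCK S) -(zeros_ind (~` S)).
Qed.

(** If [f] is not in [z], then the [x] with [f x] outside [m x] form a set of
    the ultrafilter of [z]. This gives the density of [X], in the precise
    form that makes extensions unique. *)
Lemma point_cvg (eta : X -> MaxG) (z : MaxG) :
  (forall x, max_of (eta x) = @prod_proj X R x @^-1` m x) ->
  eta @ ultra_of z --> z.
Proof.
move=> etaE; apply/cvg_maxspecP => f.
move=> /ultra_of_zeros/(ultra_setC _ (ultra_of_ultra z)).
by apply: filterS => x; rewrite /= etaE.
Qed.

Lemma maxspec_stone_cech (eta : discrete_topology {classic X} -> MaxG) :
  (forall x, max_of (eta x) = @prod_proj X R x @^-1` m x) ->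
  is_stone_cech eta.
Proof.
move=> etaE; split.
- by split; [exact: maxspec_compact|exact: maxspec_hausdorff].
- move=> x V /nbhs_singleton Vx; apply: open_nbhs_nbhs; split=> //.
  exact: discrete_open.
move=> Y phi [Ycpt Yhaus] _.
have lim z : exists y : Y, phi @ ultra_of z --> y.
  have phiU := ultra_fmap phi (ultra_of_ultra z).
  move: Ycpt; rewrite compact_ultra => /(_ _ phiU filterT)[y [_ ?]].
  by exists y.
have /choice[psi psiP] := lim.
have uniq z (y : Y) : phi @ ultra_of z --> y -> y = psi z.
  by move=> zy; apply: (cvg_unique Yhaus zy (psiP z)).
exists psi; split; first split.
- move=> z V psiV.
  (* Points near [z] are sent into the closure of [C], so a closed
     neighbourhood inside [V] is needed. *)
  have [C nC CV] := compact_regular Yhaus Ycpt filterT psiV.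
  have zC : ultra_of z (phi @^-1` C) by apply: psiP nC.
  apply: filterS (nbhs_ultra_of zC) => w wC; apply: CV => B nB.
  have wB : ultra_of w (phi @^-1` B) by apply: psiP nB.
  have [x [Cx Bx]] := @filter_ex _ (ultra_of w) _ _ (filterI wC wB).
  by exists (phi x).
- apply/funext => x; apply: uniq => B /nbhs_singleton Bx.
  exact/(ultra_of_principal _ (etaE x)).
move=> psi' [psi'c psi'E]; apply/funext => z; rewrite [RHS](uniq z (psi' z))//.
by rewrite psi'E; apply: cvg_comp (point_cvg etaE) (psi'c z).
Qed.

End ProductOfLocalRings.

Theorem theorem5p4 (X : Type) (R : X -> comPzRingType)
    (m : forall x : X, set (R x))
    (R_local : forall x : X, local_ring (R x))
    (m_max : forall x : X, maximal_ideal (m x)) :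
  exists M_max : forall x : X,
      maximal_ideal (@prod_proj X R x @^-1` m x : set (prod_ring R)),
    is_stone_cech
      (fun x : discrete_topology {classic X} => maxspec_point (M_max x)).
Proof.
have M_max x : maximal_ideal (@prod_proj X R x @^-1` m x : set (prod_ring R)).
  rewrite -principal_ultra_ideal.
  exact: (ultra_ideal_maximal m_max (principal_filter_ultra x)).
by exists M_max; apply: (maxspec_stone_cech m_max R_local).
Qed.
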